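(* Let $\lambda$ be an infinite cardinal and let $X$ be a quasiregular topological space with $F(X) \le \lambda$ such that $(2^\lambda,\lambda)$ is a pinning down pair for $X$. Then $d(X) \le \lambda$.
   Context: No separation axioms are assumed unless stated. For cardinals $\kappa > \lambda \ge \omega$, $(\kappa,\lambda)$ is a pinning down pair for a topological space $X$ if for every family $\mathcal{U}$ of non-empty open sets in $X$ with $|\mathcal{U}| \le \kappa$ there is $B \subset X$ with $|B| \le \lambda$ such that $B \cap U \ne \emptyset$ for each $U \in \mathcal{U}$. A space $X$ is quasiregular if every non-empty open set in $X$ includes a non-empty regular closed set. A sequence $\langle x_\alpha : \alpha < \eta\rangle$ of distinct points of $X$ is a free sequence if $\overline{\{x_\alpha : \alpha < \beta\}} \cap \overline{\{x_\alpha : \beta \le \alpha < \eta\}} = \emptyset$ for every $\beta < \eta$; a subset of $X$ is free if it has a well-ordering that turns it into a free sequence; $F(X)$ is the supremum of the cardinalities of the free subsets of $X$. $d(X)$ is the density of $X$. *)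

(* Defs.v *)
From mathcomp Require Import all_boot.
From mathcomp Require Import boolp classical_sets functions cardinality.
From mathcomp Require Import wochoice topology.

Set Implicit Arguments.
Unset Strict Implicit.
Unset Printing Implicit Defensive.

Local Open Scope classical_set_scope.
Local Open Scope card_scope.

(* A cardinal is represented by a type of that cardinality: for a set A and a
   type L, A #<= [set: L] says |A| <= |L|, and set L has cardinality 2^|L|. *)

Definition pinning_down_pair (X : topologicalType) (K L : Type) : Prop :=
  forall U : set (set X),
    (forall O, U O -> open O /\ O !=set0) ->
    U #<= [set: K] ->
    exists B : set X, B #<= [set: L] /\ (forall O, U O -> B `&` O !=set0).

Definition quasiregular (X : topologicalType) : Prop :=
  forall O : set X, open O -> O !=set0 ->
    exists C : set X, [/\ regclosed C, C !=set0 & C `<=` O].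

(* The index set, an ordinal in the usual definition, is a type I well-ordered
   by the non-strict relation R; thus ~~ R b a means a < b. *)
Definition free_sequence (X : topologicalType) (I : Type) (R : rel I)
    (x : I -> X) : Prop :=
  [/\ well_order R, injective x &
      forall b : I,
        closure (x @` [set a | ~~ R b a]) `&` closure (x @` [set a | R b a])
          = set0].

Definition free_set (X : topologicalType) (S : set X) : Prop :=
  exists R : rel S, free_sequence R (fun s : S => val s).

(* F(X) <= |L|, F(X) being the supremum of the cardinalities of the free
   subsets. *)
Definition free_number_le (X : topologicalType) (L : Type) : Prop :=
  forall S : set X, free_set S -> S #<= [set: L].

(* d(X) <= |L|, d(X) being the least cardinality of a dense subset. *)
Definition density_le (X : topologicalType) (L : Type) : Prop :=
  exists D : set X, dense D /\ D #<= [set: L].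

(* Main.v *)
(** Suppose that no subset of X of size at most |L| is dense. By quasiregularity,
every f : L -> X then has a closed set g f with non-empty interior that misses
the closure of range f. Let Y contain a point of every non-empty intersection of
at most |L| sets g f with f : L -> Y; such a Y exists with |Y| <= 2^|L|. Let B
pin down the interiors of the sets g f with f : L -> Y. Some b in B has the
property that every A included in Y with |A| <= |L| is separated from b, i.e.
b lies in some g f, with f : L -> Y, missing the closure of A: otherwise pick a
bad A_b for each b; the union of the A_b has at most |L| points and is missed by
some g f whose interior contains some b in B, so A_b was not bad. Now choose x_a
by recursion in Y and in all the sets separating b from {x_d : d < c}, c <= a;
these sets have b in common, so the recursion proceeds for |L|^+ steps, and
yields a free sequence. *)

Require Import Defs.
From mathcomp Require Import all_boot.
From mathcomp Require Import boolp classical_sets functions cardinality.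
From mathcomp Require Import wochoice topology.

Local Open Scope classical_set_scope.

(** * Cardinal inequalities as injections and surjections *)

Lemma injective_card_le (T U : Type) (A : set T) (B : set U) (f : T -> U) :
  (forall x, A x -> B (f x)) ->
  (forall x y, A x -> A y -> f x = f y -> x = y) -> (A #<= B)%card.
Proof.
move=> AB injf; have [g] : $|{injfun A >-> B}|.
  apply/injfunPex; exists f => // x y /set_mem Ax /set_mem Ay; exact: injf.
exact: inj_card_le.
Qed.

Lemma card_le_injective (T U : Type) (A : set T) (B : set U) :
  B !=set0 -> (A #<= B)%card ->
  exists2 f : T -> U, (forall x, A x -> B (f x)) &
    (forall x y, A x -> A y -> f x = f y -> x = y).
Proof.
elim/Ppointed: U => U in B *; first by rewrite emptyE => -[].
move=> _ /pcard_leP/injfunPex[f AB injf]; exists f => // x y Ax Ay.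
by apply: injf; apply/mem_set.
Qed.

Lemma card_leT_injective (T U : Type) :
  [set: U] !=set0 -> ([set: T] #<= [set: U])%card ->
  exists f : T -> U, injective f.
Proof.
move=> U0 TU; have [f _ finj] := card_le_injective _ _ _ _ U0 TU.
by exists f => x y; exact: finj.
Qed.

Lemma card_le_neq0 (T U : Type) (A : set T) (B : set U) :
  A !=set0 -> (A #<= B)%card -> B !=set0.
Proof.
move=> [a Aa] AB; apply/set0P/eqP => B0.
by move: AB Aa; rewrite B0 => /card_le0P->.
Qed.

Lemma card_le_range (T L : Type) (A : set T) :
  A !=set0 -> (A #<= [set: L])%card -> exists f : L -> T, A = range f.
Proof.
move=> [x Ax] /pfcard_geP[A0|[f]]; first by rewrite A0 in Ax.
have : $|{surjfun [set: L] >-> A}| by squash f.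
by move=> /surjfunPex.
Qed.

(** Choosing a related element for each point of [A] gives an injection. Thus a graph suffices for
    comparing cardinals. *)
Lemma relation_card_le (T U : Type) (R : T -> U -> Prop) (A : set T)
    (B : set U) :
  (forall t, A t -> exists2 u, B u & R t u) ->
  (forall t t' u, R t u -> R t' u -> t = t') -> (A #<= B)%card.
Proof.
move=> RAB Rinj.
have [[a Aa]|A0] := pselect (A !=set0); last first.
  have -> : A = set0 by apply/seteqP; split=> // x Ax; apply: A0; exists x.
  exact: card_ge0.
have [u0 _ _] := RAB _ Aa.
have /choice[f fAB] : forall t, exists u, A t -> B u /\ R t u.
  move=> t; have [At|nAt] := pselect (A t); last by exists u0.
  by have [u Bu Rtu] := RAB _ At; exists u.
apply: (@injective_card_le _ _ _ _ f) => [t At|t t' At At' ff].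
  exact: (fAB _ At).1.
by apply: (Rinj _ _ (f t)); [|rewrite ff]; apply: (fAB _ _).2.
Qed.

(** * Comparability of cardinals, and arithmetic of infinite ones *)

Lemma card_le_total (T U : Type) (A : set T) (B : set U) :
  (A #<= B)%card \/ (B #<= A)%card.
Proof.
pose P (G : set (T * U)) :=
  (forall t u, G (t, u) -> A t /\ B u) /\
  (forall t u t' u', G (t, u) -> G (t', u') -> t = t' <-> u = u').
have [F FP Fchain|G [[GAB Gbij] Gmax]] := @Zorn_bigcup _ P.
  split=> [t u [G FG Gtu]|t u t' u' [G FG Gtu] [G' FG' Gtu']].
    exact: (FP _ FG).1 Gtu.
  have [GG'|G'G] := Fchain _ _ FG FG'.
    by apply: (FP _ FG').2 => //; exact: GG'.
  by apply: (FP _ FG).2 => //; exact: G'G.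
have [AG|/existsNP[a /not_implyP[Aa /forallNP aG]]] :=
    pselect (forall t, A t -> exists u, G (t, u)).
  left; apply: (@relation_card_le _ _ (fun t u => G (t, u))) => [t At|t t' u].
    by have [u Gtu] := AG _ At; exists u => //; exact: (GAB _ _ Gtu).2.
  by move=> Gtu Gtu'; apply/(Gbij _ _ _ _ Gtu Gtu').
have [BG|/existsNP[b /not_implyP[Bb /forallNP bG]]] :=
    pselect (forall u, B u -> exists t, G (t, u)).
  right; apply: (@relation_card_le _ _ (fun u t => G (t, u))) => [u Bu|u u' t].
    by have [t Gtu] := BG _ Bu; exists t => //; exact: (GAB _ _ Gtu).1.
  by move=> Gtu Gtu'; apply/(Gbij _ _ _ _ Gtu Gtu').
case: (Gmax ((a, b) |` G)).
  split=> [p Gp|/(_ (a, b)) Gab]; first by right.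
  by apply: (aG b); apply: Gab; left.
split=> [t u|t u t' u'].
  by move=> [[-> ->]|/GAB].
rewrite /setU /=.
move=> [[-> ->]|Gtu] [[-> ->]|Gtu'] //; last exact: Gbij.
- by split=> [ta|ub]; [case: (aG u')|case: (bG t')]; rewrite ?ta ?ub.
- by split=> [ta|ub]; [case: (aG u)|case: (bG t)]; rewrite -?ta -?ub.
Qed.

(* Zorn's lemma on the graphs G of injections from D G * D G to D G; a maximal
   G with D G <= ~` D G extends to D G and a disjoint copy j @` D G of it. *)
Lemma infinite_card_setX (L : Type) :
  infinite_set [set: L] -> ([set: L * L] #<= [set: L])%card.
Proof.
move=> Linf; have L0 := infinite_setN0 Linf; move/infiniteP: Linf => natL.
pose D (G : set (L * L * L)) := [set x | exists z, G (x, x, z)].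
pose Q (G : set (L * L * L)) := [/\
  forall x y z, G (x, y, z) -> [/\ D G x, D G y & D G z],
  forall x y, D G x -> D G y -> exists z, G (x, y, z) &
  forall x y z x' y' z', G (x, y, z) -> G (x', y', z') ->
    (x, y) = (x', y') <-> z = z'].
(* The empty graph is exempt, being the union of the empty chain. *)
pose P G := Q G /\ (G !=set0 -> ([set: nat] #<= D G)%card).
have DS G H : G `<=` H -> D G `<=` D H.
  by move=> GH x [z Gz]; exists z; exact: GH.
have [F FP Fchain|G [[[GD DG Gbij] Ginf] Gmax]] := @Zorn_bigcup _ P.
  have common G H : F G -> F H -> exists2 K, F K & G `<=` K /\ H `<=` K.
    move=> FG FH; have [GH|HG] := Fchain _ _ FG FH.
      by exists H => //; split=> //; exact: subset_refl.
    by exists G => //; split=> //; exact: subset_refl.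
  split; first split.
  - move=> x y z [G FG Gz]; have [[GD _ _] _] := FP _ FG.
    have /DS DGF := bigcup_sup FG (F := id).
    by have [Dx Dy Dz] := GD _ _ _ Gz; split; exact: DGF.
  - move=> x y [z [G FG Gz]] [t [H FH Ht]].
    have [K FK [GK HK]] := common _ _ FG FH.
    have [[_ DK _] _] := FP _ FK.
    have [||w Kw] := DK x y; [by exists z; exact: GK|by exists t; exact: HK|].
    by exists w, K.
  - move=> x y z x' y' z' [G FG Gz] [H FH Hz].
    have [K FK [GK HK]] := common _ _ FG FH.
    by have [[_ _ Kbij] _] := FP _ FK; apply: Kbij; [exact: GK|exact: HK].
  - move=> [p [G FG Gp]]; have [_ Ginf] := FP _ FG.
    apply: (card_le_trans (Ginf _)); first by exists p.
    exact/subset_card_le/DS/(bigcup_sup FG).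
have {}natD : ([set: nat] #<= D G)%card.
  apply: Ginf; apply/set0P/eqP => G0.
  have [i iinj] := card_leT_injective _ _ L0 natL.
  (* A pairing of the natural numbers, carried to [L] by [i], properly extends the empty graph. *)
  pose H := [set p | exists n m : nat,
    p = (i n, i m, i (choice.pickle (n, m)))].
  have DH n : D H (i n) by exists (i (choice.pickle (n, n))), n, n.
  case: (Gmax H).
    rewrite G0; split=> // HG.
    by apply: (HG (i 0, i 0, i (choice.pickle (0, 0)))); exists 0, 0.
  split.
    split.
    - by move=> x y z [n [m [-> -> ->]]].
    - move=> x y [z [n [n' [-> _ _]]]] [t [m [m' [-> _ _]]]].
      by exists (i (choice.pickle (n, m))), n, m.
    - move=> x y z x' y' z' [n [m [-> -> ->]]] [n' [m' [-> -> ->]]].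
      split=> [[/iinj nn /iinj mm]|/iinj zz].
        by rewrite nn mm.
      by have [-> ->] := pcan_inj choice.pickleK zz.
  by move=> _; apply: (@injective_card_le _ _ _ _ i) => // n m _ _ /iinj.
have /choice[f0 Gf0] : forall p, exists z, D G p.1 -> D G p.2 -> G (p, z).
  move=> [x y]; have [[Dx Dy]|nD] := pselect (D G x /\ D G y).
    by have [z Gz] := DG _ _ Dx Dy; exists z.
  by case: L0 => z _; exists z => Dx Dy; case: nD.
pose f x y := f0 (x, y).
have Gf x y : D G x -> D G y -> G (x, y, f x y) by exact: (Gf0 (x, y)).
have Df x y : D G x -> D G y -> D G (f x y).
  by move=> Dx Dy; have [] := GD _ _ _ (Gf _ _ Dx Dy).
have finj x y x' y' : D G x -> D G y -> D G x' -> D G y' ->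
    f x y = f x' y' -> x = x' /\ y = y'.
  move=> Dx Dy Dx' Dy'.
  by move=> /(Gbij _ _ _ _ _ _ (Gf _ _ Dx Dy) (Gf _ _ Dx' Dy'))[-> ->].
(* Four distinct points of [D G] serve as tags that keep the images of different cases apart. *)
have [e De einj] : exists2 e : bool * bool -> L,
    forall b, D G (e b) & injective e.
  have D0 : D G !=set0 by apply: card_le_neq0 natD; exists 0.
  have [i iD iinj] := card_le_injective _ _ _ _ D0 natD.
  exists (fun b => i (choice.pickle b)) => [b|b b' /iinj bb]; first exact: iD.
  by apply: (pcan_inj choice.pickleK); exact: bb.
(* If the complement injects into [D G], then so does [L], and [f] pairs inside [D G]; otherwise [G]
   is not maximal. *)
have [DC|CD] := card_le_total _ _ (D G) (~` D G); last first.
  have [k kD kinj] : exists2 k : L -> L,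
      forall x, D G (k x) & injective k.
    have [|k kD kinj] := card_le_injective _ _ _ _ _ CD.
      by exists (e (true, true)).
    exists (fun x => if x \in D G then f (e (true, true)) x
                     else f (e (true, false)) (k x)) => [x|x y].
      case: ifPn => [/set_mem Dx|xD]; apply: Df => //; apply: kD.
      by rewrite notin_setE in xD.
    case: ifPn => xD; case: ifPn => yD;
      rewrite ?notin_setE ?in_setE in xD yD => /finj[] //; try exact: kD.
    - by move=> /einj.
    - by move=> /einj.
    - by move=> _; exact: kinj.
  apply: (@injective_card_le _ _ _ _ (fun p => f (k p.1) (k p.2))) => //.
  move=> [x y] [x' y'] _ _ /= /finj[]// /kinj -> /kinj ->//.
have [j jD jinj] : exists2 j : L -> L, forall x, D G x -> ~ D G (j x) &
    forall x y, D G x -> D G y -> j x = j y -> x = y.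
  have [|j jD jinj] := card_le_injective _ _ _ _ _ DC; last by exists j.
  by apply: card_le_neq0 DC; exists (e (true, true)).
pose J (b : bool) x := if b then j x else x.
have Jinj b x b' x' : D G x -> D G x' -> J b x = J b' x' -> b = b' /\ x = x'.
  case: b b' => -[] Dx Dx' //=.
  - by move=> /jinj ->.
  - by move=> jx; case: (jD _ Dx); rewrite jx.
  - by move=> jx; case: (jD _ Dx'); rewrite -jx.
(* Pairs from [D G] keep their value; the three other kinds of pairs are sent into the copy, each
   under its own tag. *)
pose h s t x y :=
  if s || t then j (f (e (s, t)) (f x y)) else f x y.
pose H := [set p | exists s t x y,
  [/\ D G x, D G y & p = (J s x, J t y, h s t x y)]].
have DH b x : D G x -> D H (J b x) by move=> Dx; exists (h b b x x), b, b, x, x.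
case: (Gmax H).
  split=> [[[x y] z] Gz|].
    have [Dx Dy _] := GD _ _ _ Gz; exists false, false, x, y; split => //=.
    by congr pair; apply/(Gbij _ _ _ _ _ _ Gz (Gf _ _ Dx Dy)).
  pose d := e (true, true); have Dd : D G d by exact: De.
  move=> HG; apply: (jD d Dd); exists (h true true d d); apply: HG.
  by exists true, true, d, d.
have hJ s t x y : exists2 z, h s t x y = J (s || t) z & (D G x -> D G y -> D G z).
  rewrite /h; case: (s || t); last by exists (f x y) => //; exact: Df.
  exists (f (e (s, t)) (f x y)) => // Dx Dy.
  exact: (Df _ _ (De _) (Df _ _ Dx Dy)).
split; first split.
- move=> x y z [s [t [x' [y' [Dx Dy [-> -> ->]]]]]]; split; try exact: DH.
  by have [z' -> Dz'] := hJ s t x' y'; apply: DH; exact: Dz'.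
- move=> x y [z [s [s' [x' [y' [Dx _ [-> _ _]]]]]]].
  move=> [w [t [t' [u [v [Du _ [-> _ _]]]]]]].
  by exists (h s t x' u), s, t, x', u.
- move=> x y z x' y' z' [s [t [a [b [Da Db [-> -> ->]]]]]].
  move=> [s' [t' [a' [b' [Da' Db' [-> -> ->]]]]]].
  split=> [[/Jinj[]// -> -> /Jinj[]// -> ->]//|].
  rewrite /h; have Dab := Df _ _ Da Db; have Dab' := Df _ _ Da' Db'.
  case: ifPn => st; case: ifPn => st'.
  + move=> /jinj/finj[||||||/einj[-> ->] /finj[]// -> ->]//; exact: Df.
  + by move=> jf; case: (jD (f (e (s, t)) (f a b))); [exact: Df|rewrite jf].
  + by move=> jf; case: (jD (f (e (s', t')) (f a' b'))); [exact: Df|rewrite -jf].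
  + case: s t s' t' st st' => -[] [] [] //= _ _.
    by move=> /finj[]// -> ->.
- move=> _; apply: (card_le_trans natD); apply: subset_card_le => x Dx.
  exact: (DH false).
Qed.

(** A list is coded by its length and its letters paired one after another; the iterated pairing
    alone might identify lists of different lengths. *)
Lemma infinite_card_seq (L : Type) :
  infinite_set [set: L] -> ([set: seq L] #<= [set: L])%card.
Proof.
move=> Linf; have L0 := infinite_setN0 Linf.
have [p pinj] := card_leT_injective _ _ L0 (infinite_card_setX _ Linf).
have [i iinj] := card_leT_injective _ _ L0 ((infiniteP _).1 Linf).
have [l _] := L0.
pose code s := foldr (fun x y => p (x, y)) l s.
apply: (@injective_card_le _ _ _ _ (fun s => p (i (size s), code s))) => //.
move=> s t _ _ /pinj[/iinj].
by elim: s t => [|x s IHs] [|y t] //= [szst] /pinj[-> /IHs->].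
Qed.

(** A point of the union is coded by the index of a set containing it and its code within that
    set. *)
Lemma infinite_card_bigcup (L I T : Type) (D : set I) (F : I -> set T) :
  infinite_set [set: L] -> (D #<= [set: L])%card ->
  (forall i, D i -> (F i #<= [set: L])%card) ->
  (\bigcup_(i in D) F i #<= [set: L])%card.
Proof.
move=> Linf DL FL; have L0 := infinite_setN0 Linf.
have [e _ einj] := card_le_injective _ _ _ _ L0 DL.
apply: card_le_trans (infinite_card_setX _ Linf).
have /choice[f finj] : forall i, exists f : T -> L, D i ->
    forall x y, F i x -> F i y -> f x = f y -> x = y.
  move=> i; have [Di|nDi] := pselect (D i); last first.
    by have [l _] := L0; exists (fun=> l).
  by have [f _ finj] := card_le_injective _ _ _ _ L0 (FL _ Di); exists f.
apply: (@relation_card_le _ _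
  (fun x p => exists i, [/\ D i, F i x & p = (e i, f i x)])).
  by move=> x [i Di Fx]; exists (e i, f i x) => //; exists i.
move=> x y _ [i [Di Fx ->]] [j [Dj Fy [/einj ij]]].
by rewrite -ij // in Fy *; apply: finj.
Qed.

Lemma infinite_card_setU1 (L T : Type) (x : T) (A : set T) :
  infinite_set [set: L] -> (A #<= [set: L])%card ->
  (x |` A #<= [set: L])%card.
Proof.
move=> Linf AL; rewrite -bigcup2inE.
apply: infinite_card_bigcup => //.
  apply: card_le_trans ((infiniteP _).1 Linf).
  exact: card_leT.
case=> [|[|//]] _ //=.
have [l _] := infinite_setN0 Linf.
apply: (@injective_card_le _ _ _ _ (fun=> l)) => // a b -> ->//.
Qed.

(** * Cantor's theorem, power sets, and the number of trees *)

(** Cantor's diagonal argument: [A] collects the codes [f B] that lie outside [B]. *)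
Lemma not_card_le_powerset (L : Type) :
  ~ ([set: set L] #<= [set: L])%card.
Proof.
move=> LL; have [|f finj] := card_leT_injective _ _ _ LL.
  by apply: card_le_neq0 LL; exists set0.
pose A := [set l | exists2 B, f B = l & ~ B l].
have [AfA|nAfA] := pselect (A (f A)).
  by move: (AfA) => [B /finj ->].
by apply: (nAfA); exists A.
Qed.

Lemma card_le_powerset (T U : Type) : [set: U] !=set0 ->
  ([set: T] #<= [set: U])%card -> ([set: set T] #<= [set: set U])%card.
Proof.
move=> U0 TU; have [f finj] := card_leT_injective _ _ U0 TU.
apply: (@injective_card_le _ _ _ _ (fun A => f @` A)) => // A B _ _ AB.
by apply/funext => x; rewrite -(image_inj (A := A) finj) AB image_inj.
Qed.

(* The closure of a point under an I-ary operation is the set of values of the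
   trees below, which bounds its size. *)
Inductive tree (I : Type) := Leaf | Node of (I -> tree I).

Arguments Leaf {I}.
Arguments Node {I}.

(** The addresses of the internal nodes. A leaf has none and a node has at least the empty one, so
    they determine the tree. *)
Fixpoint tree_paths (I : Type) (t : tree I) : set (seq I) :=
  if t is Node f then
    [set s | if s is i :: s' then tree_paths I (f i) s' else True]
  else set0.

Lemma tree_paths_inj (I : Type) : injective (@tree_paths I).
Proof.
elim=> [|f IHf] [|g] //=.
- by move=> /seteqP[_ /(_ nil)]; case.
- by move=> /seteqP[/(_ nil) + _]; case.
- move=> fg; congr Node; apply/funext => i; apply: IHf.
  by apply/funext => s; exact: (congr1 (fun A : set (seq I) => A (i :: s)) fg).
Qed.

Lemma card_tree (I L : Type) : [set: L] !=set0 ->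
  ([set: seq I] #<= [set: L])%card ->  ([set: tree I] #<= [set: set L])%card.
Proof.
move=> L0 IL; apply: card_le_trans (card_le_powerset _ _ L0 IL).
apply: (@injective_card_le _ _ _ _ (tree_paths I)) => // s t _ _.
exact: tree_paths_inj.
Qed.

(** * Well-orders: minima, induction and linearity *)

Lemma well_order_min (W : Type) (R : rel W) (P : W -> Prop) (a : W) :
  well_order R -> P a -> exists2 m, P m & forall b, P b -> R m b.
Proof.
move=> Rwo Pa; have [|m [[/asboolP Pm mmin] _]] := Rwo (fun b => `[< P b >]).
  by exists a; apply/asboolP.
by exists m => // b Pb; apply: (mmin b); apply/asboolP.
Qed.

Lemma well_order_wf (W : Type) (R : rel W) :
  well_order R -> well_founded (fun a b => ~~ R b a).
Proof.
move=> Rwo a; apply: contrapT => nacc.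
have [m nm mmin] := well_order_min _ _ (fun a => ~ Acc _ a) _ Rwo nacc.
apply: nm; constructor => c /negP Rmc; apply: contrapT => nc.
by apply: Rmc; apply: mmin.
Qed.

Lemma well_order_total_order (W : eqType) (R : rel W) :
  well_order R -> total_order R.
Proof.
move=> Rwo; have Rchain : wo_chain R predT by exact: withinW.
have Rtot : total R by move=> a b; exact: (wo_chainW Rchain).
have Rxx : reflexive R by move=> a; exact: (wo_chain_reflexive Rchain).
have Ranti : antisymmetric R.
  by move=> a b; exact: (wo_chain_antisymmetric Rchain).
split=> //; split=> //; split=> // b a c Rab Rbc.
(* Transitivity comes from the least of the three points: unless it is [a], antisymmetry identifies
   it with its predecessor. *)
have [|m] := well_order_min _ _ (fun x => x \in [:: a; b; c]) a Rwo.
  exact: mem_head.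
rewrite !inE => /or3P[] /eqP-> mmin.
- by apply: mmin; rewrite !inE eqxx !orbT.
- by rewrite (Ranti a b) // Rab; apply: mmin; rewrite inE eqxx.
- by rewrite -(Ranti b c) // Rbc; apply: mmin; rewrite !inE eqxx orbT.
Qed.

(** * A free sequence longer than |L|, by transfinite recursion *)

(* If A is the set of terms of the sequence before a stage, then kappa A will
   contain all the terms from that stage on. *)
Lemma free_set_of_separation (X : topologicalType) (L : Type) (Y : set X)
    (kappa : set X -> set X) :
  infinite_set [set: L] ->
  (forall A, A `<=` Y -> (A #<= [set: L])%card ->
     closed (kappa A) /\ closure A `&` kappa A = set0) ->
  (forall C : set (set X), C !=set0 -> (C #<= [set: L])%card ->
     (forall A, C A -> A `<=` Y /\ (A #<= [set: L])%card) ->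
     Y `&` \bigcap_(A in C) kappa A !=set0) ->
  exists2 S : set X, free_set S & ~ (S #<= [set: L])%card.
Proof.
move=> Linf ksep kmeet.
have [x0 _] : exists x, Y x.
  have [|||x [Yx _]] := kmeet [set set0]; last by exists x.
  - by exists set0.
  - apply: card_le_trans (card_image_le (fun=> set0) [set: L]).
    by apply: subset_card_le => _ ->; have [l _] := infinite_setN0 Linf; exists l.
  - by move=> _ ->; split => //; exact: card_ge0.
(* Any well-ordered type with more than |L| elements would do here. *)
pose W := set L; have [R Rwo] := well_ordering_principle W.
pose lt a b := ~~ R b a.
have ltwf : well_founded lt := well_order_wf _ _ Rwo.
have [[[Rxx Rtrans] Rasym] Rtotal] := well_order_total_order _ _ Rwo.
have Rtot a b : R a b \/ R b a by apply/orP.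
have Ranti a b : R a b -> R b a -> a = b.
  by move=> ab ba; apply: Rasym; rewrite ab.
have Rtr a b c : R a b -> R b c -> R a c by exact: Rtrans.
have ltW a b : lt a b -> R a b.
  by move=> /negP ab; have [//|ba] := Rtot a b; case: ab.
pose init (x : W -> X) c := x @` [set d | lt d c].
pose target (x : W -> X) a :=
  Y `&` \bigcap_(A in [set init x c | c in [set c | R c a]]) kappa A.
have target_ext x y a : (forall b, lt b a -> x b = y b) ->
    target x a = target y a.
  move=> xy; congr (_ `&` _); congr bigcap; apply: eq_imagel => c /= ca.
  apply: eq_imagel => d /= dc; apply: xy; apply/negP => ad.
  by move/negP: dc; apply; exact: Rtr ca ad.
have [x xE] : exists x : W -> X, forall a, x a = xget x0 (target x a).
  (* The earlier values are extended by [x0], which is harmless since [target] at [a] looks only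
     below [a]. An empty target also gives [x0]; this never happens on [I]. *)
  pose step a (r : forall b, lt b a -> X) : X :=
    xget x0 (target
      (fun b => if pselect (lt b a) is left ba then r b ba else x0) a).
  exists (Fix ltwf (fun=> X) step) => a.
  rewrite Fix_eq; last first.
    move=> b r r' rr'; rewrite /step; congr (xget x0 (target _ _)).
    by apply/funext => c; case: pselect.
  congr xget; apply: target_ext => b ba; by case: pselect.
(* The stages with at most |L| predecessors, which play the role of the successor cardinal of
   |L|. *)
pose I := [set a | ([set c | R c a] #<= [set: L])%card].
have Idown a c : I a -> R c a -> I c.
  move=> Ia ca; apply: card_le_trans Ia; apply: subset_card_le => d dc.
  exact: Rtr dc ca.
have initL c : I c -> (init x c #<= [set: L])%card.
  move=> Ic; apply: (card_le_trans (card_image_le _ _)).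
  apply: card_le_trans Ic; apply: subset_card_le => d.
  exact: ltW.
have xI a : I a -> target x a (x a).
  elim/(well_founded_ind ltwf): a => a IH Ia.
  rewrite xE; apply: xgetPex; apply: kmeet.
  - by exists (init x a); exists a => /=.
  - exact: card_le_trans (card_image_le _ _) Ia.
  - move=> _ [c /= ca <-]; have Ic := Idown _ _ Ia ca; split; last exact: initL.
    move=> _ [d /= dc <-]; have da : lt d a.
      by apply/negP => ad; move/negP: dc; apply; exact: Rtr ca ad.
    by have [] := IH _ da (Idown _ _ Ia (ltW _ _ da)).
have initY c : I c -> init x c `<=` Y.
  move=> Ic _ [d /= dc <-]; by have [] := xI _ (Idown _ _ Ic (ltW _ _ dc)).
have xkappa a c : I a -> R c a -> kappa (init x c) (x a).
  by move=> Ia ca; have [_] := xI _ Ia; apply; exists c.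
have ltne a d : I a -> lt d a -> x d <> x a.
  move=> Ia da xda; have [_ sep] := ksep _ (initY _ Ia) (initL _ Ia).
  suff : (closure (init x a) `&` kappa (init x a)) (x a) by rewrite sep.
  split; last exact: xkappa.
  by apply: subset_closure; exists d.
have xinj a b : I a -> I b -> x a = x b -> a = b.
  move=> Ia Ib xab; apply: Ranti; apply/negPn/negP => ab.
  - exact: (ltne _ _ Ia ab).
  - exact: (ltne _ _ Ib ab).
exists (x @` I); last first.
  move=> IL; have {IL} IL : (I #<= [set: L])%card.
    by apply: card_le_trans IL; apply: (@injective_card_le _ _ _ _ x).
  have [IT|/existsNP[a nIa]] := pselect (forall a, I a).
    apply: (not_card_le_powerset L); apply: card_le_trans IL.
    exact: subset_card_le.
  (* Everything strictly below the least [m] outside [I] is in [I], so |I| <= |L| would put [m]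
     itself in [I]. *)
  have [m nIm mmin] := well_order_min _ _ (fun a => ~ I a) _ Rwo nIa.
  apply: nIm; apply: card_le_trans (infinite_card_setU1 _ _ m _ Linf IL).
  apply: subset_card_le => c /= cm; have [Ic|nIc] := pselect (I c); first by right.
  left; apply: Ranti => //; exact: mmin.
have /choice[inv invP] : forall s : x @` I, exists a, I a /\ x a = val s.
  by move=> [s /= /set_mem[a Ia <-]]; exists a.
exists (fun s t => R (inv s) (inv t)); split.
- apply: antisymmetric_well_order => [s t /andP[st ts]|A [s As]].
    by apply: val_inj; rewrite -(invP s).2 -(invP t).2; congr x; exact: Ranti.
  have [|_ [t At <-] tmin] := well_order_min _ _
    (fun a => exists2 t, t \in A & inv t = a) (inv s) Rwo; first by exists s.
  by exists t; split=> // u Au; apply: tmin; exists u.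
- exact: val_inj.
- move=> s; have [Ia _] := invP s.
  have [kcl sep] := ksep _ (initY _ Ia) (initL _ Ia).
  (* The terms before [s] lie in [init x (inv s)], the others in the closed set that [kappa] assigns
     to it. *)
  rewrite -subset0 -sep; apply: setISS.
    apply: closureS => _ [t /= ts <-]; exists (inv t) => //.
    exact: (invP t).2.
  rewrite [X in _ `<=` X](closure_id _).1//; apply: closureS => _ [t /= st <-].
  rewrite -(invP t).2; apply: xkappa => //; exact: (invP t).1.
Qed.

(** * Separation by quasiregularity, and the density bound *)

(** A non-dense [A] misses a non-empty open [O], hence so does its closure. A non-empty regular
    closed [K] inside [O] has non-empty interior, being the closure of that interior. *)
Lemma quasiregular_separation (X : topologicalType) (A : set X) :
  quasiregular X -> ~ dense A ->
  exists K : set X, [/\ closed K, K° !=set0 & closure A `&` K = set0].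
Proof.
move=> qX /denseNE[O [[x [oO Ox]] OA]].
have [|K [rK [y Ky] KO]] := qX O oO; first by exists x.
exists K; split.
- by rewrite -rK; exact: closed_closure.
- apply/set0P/eqP => K0; move: Ky; rewrite -rK K0 closure0//.
- have AO : closure A `<=` ~` O.
    rewrite [X in _ `<=` X](closure_id _).1; last exact: open_closedC.
    by apply: closureS => z Az Oz; rewrite -[False]/(set0 z) -OA.
  by rewrite -subset0 => z [/AO nOz /KO].
Qed.

(** The values over all trees form the least set containing [x0] and closed under [h]. *)
Fixpoint eval_tree (I X : Type) (x0 : X) (h : (I -> X) -> X) (t : tree I) : X :=
  if t is Node f then h (fun i => eval_tree I X x0 h (f i)) else x0.

Theorem corollary2p5 (L : Type) (X : topologicalType)
    (infinite_L : infinite_set [set: L])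
    (quasiregular_X : quasiregular X)
    (F_le : free_number_le X L)
    (pinned : pinning_down_pair X (set L) L) :
  density_le X L.
Proof.
apply: contrapT => not_dense.
have [l0 _] := infinite_setN0 infinite_L.
have LL := infinite_card_setX _ infinite_L.
have /choice[g gsep] : forall f : L -> X, exists K : set X,
    [/\ closed K, K° !=set0 & closure (range f) `&` K = set0].
  move=> f; apply: quasiregular_separation => // fd; apply: not_dense.
  by exists (range f); split=> //; exact: card_image_le.
have [x0 _] : exists x : X, True.
  apply: contrapT => noX; apply: not_dense; exists set0; split.
    by move=> O [x _]; case: noX; exists x.
  exact: card_ge0.
(* A function on [L * L] is a family of |L| functions on [L], so a single operation [h] picks points
   in all the intersections. *)
have /choice[h hmeet] : forall F : L * L -> X, exists y,
    \bigcap_l g (fun m => F (l, m)) !=set0 ->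
    (\bigcap_l g (fun m => F (l, m))) y.
  move=> F; have [[y Fy]|F0] :=
    pselect (\bigcap_l g (fun m => F (l, m)) !=set0).
    by exists y.
  by exists x0.
pose ev := eval_tree (L * L) X x0 h.
pose Y := range ev.
have Yclosed (F : L -> L -> X) : (forall l m, Y (F l m)) ->
    \bigcap_l g (F l) !=set0 -> Y `&` \bigcap_l g (F l) !=set0.
  move=> FY F0; have /choice[T TF] : forall p, exists t, ev t = F p.1 p.2.
    by move=> [l m]; have [t _ <-] := FY l m; exists t.
  pose F' := fun p => ev (T p).
  have F'E : (fun l => g (fun m => F' (l, m))) = (fun l => g (F l)).
    by apply/funext => l; congr g; apply/funext => m; rewrite /F' TF.
  exists (h F'); split; first by exists (Node T).
  by have := hmeet F'; rewrite F'E; apply.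
have [B [BL BU]] : exists B : set X, (B #<= [set: L])%card /\
    forall t : L -> tree (L * L), B `&` (g (fun l => ev (t l)))° !=set0.
  have [||B [BL BU]] := pinned
    (range (fun t : L -> tree (L * L) => (g (fun l => ev (t l)))°)).
  - move=> _ [t _ <-]; split; first exact: open_interior.
    by have [] := gsep (fun l => ev (t l)).
  - apply: (card_le_trans (card_image_le _ _)).
    have treeL : ([set: tree (L * L)] #<= [set: set L])%card.
      apply: card_tree; first by exists l0.
      apply: card_le_trans LL; apply: infinite_card_seq.
      rewrite -setXTT; exact: infinite_setX.
    apply: card_le_trans treeL.
    (* A family of trees indexed by [L] is itself coded by one tree, so at most 2^|L| interiors are
       to be pinned. *)
    apply: (@injective_card_le _ _ _ _
      (fun t => Node (fun p : L * L => t p.1))) => //.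
    move=> t t' _ _ [tt']; apply/funext => l.
    by have := congr1 (fun u => u (l, l)) tt'.
  - by exists B; split=> // t; apply: BU; exists t.
have [b bsep] : exists b, forall f : L -> X, (forall l, Y (f l)) ->
    exists f' : L -> X, [/\ forall l, Y (f' l), g f' b &
      closure (range f) `&` g f' = set0].
  apply: contrapT => /forallNP nb.
  have /choice[bad badP] : forall b, exists f : L -> X, (forall l, Y (f l)) /\
      ~ exists f' : L -> X, [/\ forall l, Y (f' l), g f' b &
      closure (range f) `&` g f' = set0].
    by move=> b; have /existsNP[f /not_implyP[? ?]] := nb b; exists f.
  pose A := \bigcup_(b in B) range (bad b).
  have AY : A `<=` Y by move=> _ [b _ [l _ <-]]; exact: (badP b).1.
  (* Pinning one interior shows that [B], and hence [A], is non-empty, so [A] is the range of a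
     function on [L]. *)
  have [b0 [Bb0 _]] := BU (fun=> Leaf).
  have [||f Af] := card_le_range _ L A.
  - by exists (bad b0 l0), b0 => //; exists l0.
  - apply: infinite_card_bigcup => // i _; exact: card_image_le.
  have fY l : Y (f l) by apply: AY; rewrite Af; exists l.
  have /choice[t tf] : forall l, exists t, ev t = f l.
    by move=> l; have [t _ <-] := fY l; exists t.
  have [b [Bb]] := BU t.
  have -> : (fun l => ev (t l)) = f by exact/funext.
  move=> /interior_subset gb; apply: (badP b).2; exists f; split=> //.
  have [_ _ sep] := gsep f; rewrite -subset0 -sep; apply: setSI.
  by apply: closureS; rewrite -Af => z badz; exists b.
have /choice[phi phiP] : forall A : set X, exists f : L -> X,
    A `<=` Y -> (A #<= [set: L])%card ->
    [/\ forall l, Y (f l), g f b & closure A `&` g f = set0].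
  move=> A; have [[AY AL]|nA] := pselect (A `<=` Y /\ (A #<= [set: L])%card);
    last by exists (fun=> x0) => ? ?; case: nA.
  (* [A] may be empty; adding [x0], the value of a leaf, makes it a range and keeps it inside
     [Y]. *)
  have [|f Af] := card_le_range _ L (x0 |` A) _
    (infinite_card_setU1 _ _ x0 _ infinite_L AL).
    by exists x0; left.
  have [l|f' [fY fb fsep]] := bsep f.
    have : (x0 |` A) (f l) by rewrite Af; exists l.
    by case=> [->|/AY//]; exists Leaf.
  exists f' => _ _; split=> //; rewrite -subset0 -fsep; apply: setSI.
  by apply: closureS; rewrite -Af; exact: subsetUr.
have [|A AY AL|C [A0 CA0] CL CY|S Sfree SL] :=
    free_set_of_separation X L Y (fun A => g (phi A)).
- exact: infinite_L.
- by have [] := phiP A AY AL; have [] := gsep (phi A).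
- have [|c CE] := card_le_range _ L C _ CL; first by exists A0.
  have Cc l : C (c l) by rewrite CE; exists l.
  have cP l := phiP _ (CY _ (Cc l)).1 (CY _ (Cc l)).2.
  (* The sets [g (phi (c l))] all contain [b], so their intersection is non-empty and meets [Y]. *)
  have [||y [Yy yc]] := Yclosed (fun l => phi (c l)).
  - by move=> l m; have [] := cP l.
  - by exists b => l _; have [] := cP l.
  exists y; split=> // _ /[!CE] -[l _ <-]; exact: yc.
- exact: SL (F_le _ Sfree).
Qed.
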